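(* Let $G$ be a Lie group with Lie algebra $\mathfrak{g}$ and let $g_1(t),\dots,g_N(t)\in G$ be the (differentiable) trajectories of $N$ agents, with left- and right-invariant velocities $\xi^l_k,\xi^r_k\in\mathfrak{g}$ and relative positions $\lambda_{ij}=g_j^{-1}g_i$, $\rho_{ij}=g_ig_j^{-1}$. Then total coordination is equivalent to the following condition in $\mathfrak{g}$ (holding at all times): $$\forall k=1,\dots,N:\quad \xi^l_k=\xi^l\in\bigcap_{i,j}\ker\big(\mathrm{Ad}_{\lambda_{ij}}-\mathrm{Id}\big)\quad\text{for a common } \xi^l,$$ or equivalently to $$\forall k=1,\dots,N:\quad \xi^r_k=\xi^r\in\bigcap_{i,j}\ker\big(\mathrm{Ad}_{\rho_{ij}}-\mathrm{Id}\big)\quad\text{for a common } \xi^r.$$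
   Context: For $h\in G$ let $L_h:g\mapsto hg$ and $R_h:g\mapsto gh$, with induced tangent maps $L_{h*}$, $R_{h*}$, and $\mathrm{Ad}_g=R_{g^{-1}*}L_{g*}:\mathfrak{g}\to\mathfrak{g}$. Velocities: $\xi^l_k=L_{g_k^{-1}*}\tfrac{d}{dt}g_k$ and $\xi^r_k=R_{g_k^{-1}*}\tfrac{d}{dt}g_k$, so that $\xi^r_k=\mathrm{Ad}_{g_k}\xi^l_k$. Left-invariant coordination means that all $\lambda_{jk}=g_k^{-1}g_j$ are constant in time; right-invariant coordination means that all $\rho_{jk}=g_jg_k^{-1}$ are constant in time; total coordination means that both hold simultaneously, for all pairs $j,k$. The common vectors $\xi^l$, $\xi^r$ may depend on time. *)

(* Defs.v *)
From HB Require Import structures.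
From mathcomp Require Import all_boot all_order all_algebra.
From mathcomp Require Import boolp classical_sets functions reals.
From mathcomp Require Import topology normedtype derive.

Set Implicit Arguments.
Unset Strict Implicit.
Unset Printing Implicit Defensive.

Import Order.TTheory GRing.Theory Num.Theory.
Import numFieldNormedType.Exports.

Local Open Scope classical_set_scope.
Local Open Scope ring_scope.

(* C^k on an open set U of a finite-dimensional space; the values of f
   outside U are irrelevant. Quantifying over all directions v makes the
   second conjunct say that the differential itself is C^k. *)
Fixpoint Ck (R : realType) (V W : normedModType R) (k : nat)
    (U : set V) (f : V -> W) : Prop :=
  if k is k'.+1 then
    (forall x, U x -> differentiable f x) /\
    (forall v, Ck k' U (fun x => 'd f x v))
  else forall x, U x -> {for x, continuous f}.

Definition Cinfty (R : realType) (V W : normedModType R)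
    (U : set V) (f : V -> W) : Prop := forall k, Ck k U f.

(* A chart of the set M, given by its domain and two total functions that are
   meaningful only on chart_dom and on its image. *)
Record chart (R : realType) (n : nat) (M : Type) := Chart {
  chart_dom : set M;
  chart_fun :> M -> 'rV[R]_n;
  chart_inv : 'rV[R]_n -> M }.

Definition chart_img (R : realType) (n : nat) (M : Type)
    (phi : chart R n M) : set 'rV[R]_n := phi @` chart_dom phi.

Definition chart_homeomorphism (R : realType) (n : nat) (M : topologicalType)
    (phi : chart R n M) : Prop :=
  [/\ open (chart_dom phi),
      open (chart_img phi),
      forall p, chart_dom phi p -> chart_inv phi (phi p) = p,
      forall p, chart_dom phi p -> {for p, continuous phi} &
      forall x, chart_img phi x -> {for x, continuous (chart_inv phi)}].

(* Besides the atlas, the structure records a preferred chart around each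
   point, used below to identify the tangent space at that point with R^n. *)
HB.mixin Record isSmoothManifold (R : realType) (n : nat) M of Topological M := {
  manifold_hausdorff : hausdorff_space M;
  manifold_second_countable : @second_countable M;
  atlas : set (chart R n M);
  atlas_homeomorphism : forall phi, atlas phi -> chart_homeomorphism phi;
  atlas_compatible : forall phi psi, atlas phi -> atlas psi ->
    Cinfty (phi @` (chart_dom phi `&` chart_dom psi)) (psi \o chart_inv phi);
  chart_at : M -> chart R n M;
  chart_at_atlas : forall p, atlas (chart_at p);
  chart_at_dom : forall p, chart_dom (chart_at p) p }.

#[short(type="smoothManifoldType")]
HB.structure Definition SmoothManifold (R : realType) (n : nat) :=
  { M of Topological M & isSmoothManifold R n M }.

Definition smooth_map (R : realType) (m n : nat)
    (M : smoothManifoldType R m) (P : smoothManifoldType R n)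
    (f : M -> P) : Prop :=
  continuous f /\
  forall (phi : chart R m M) (psi : chart R n P), atlas phi -> atlas psi ->
    Cinfty [set x | chart_img phi x /\ chart_dom psi (f (chart_inv phi x))]
           (psi \o f \o chart_inv phi).

(* Smoothness of f as a map on the product manifold M1 x M2, read in the
   product charts. *)
Definition smooth_map2 (R : realType) (m1 m2 n : nat)
    (M1 : smoothManifoldType R m1) (M2 : smoothManifoldType R m2)
    (P : smoothManifoldType R n) (f : M1 -> M2 -> P) : Prop :=
  continuous (fun pq : M1 * M2 => f pq.1 pq.2) /\
  forall (phi1 : chart R m1 M1) (phi2 : chart R m2 M2) (psi : chart R n P),
    atlas phi1 -> atlas phi2 -> atlas psi ->
    Cinfty [set x : 'rV[R]_m1 * 'rV[R]_m2 |
              [/\ chart_img phi1 x.1, chart_img phi2 x.2 &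
                  chart_dom psi (f (chart_inv phi1 x.1) (chart_inv phi2 x.2))]]
           (fun x => psi (f (chart_inv phi1 x.1) (chart_inv phi2 x.2))).

HB.mixin Record isLieGroup (R : realType) (n : nat) G
    of Group G & SmoothManifold R n G := {
  lie_mul_smooth : smooth_map2 (fun g h : G => (g * h)%g);
  lie_inv_smooth : smooth_map (fun g : G => (g^-1)%g) }.

#[short(type="lieGroupType")]
HB.structure Definition LieGroup (R : realType) (n : nat) :=
  { G of Group G & SmoothManifold R n G & isLieGroup R n G }.

(* T_p M, a vector being given by its coordinates in the chart chart_at p. *)
Definition tangent (R : realType) (n : nat) (M : smoothManifoldType R n)
  (p : M) : Type := 'rV[R]_n.

(* f_* at p: the differential of f read in the charts chart_at p and
   chart_at (f p). *)
Definition tangent_map (R : realType) (m n : nat)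
    (M : smoothManifoldType R m) (P : smoothManifoldType R n)
    (f : M -> P) (p : M) (v : tangent p) : tangent (f p) :=
  'd (chart_at (f p) \o f \o chart_inv (chart_at p)) (chart_at p p) v.

(* Continuity at t is required explicitly: chart_at (c t) has unspecified
   values outside its domain. *)
Definition differentiable_curve (R : realType) (n : nat)
    (M : smoothManifoldType R n) (c : R -> M) (t : R) : Prop :=
  {for t, continuous c} /\ derivable (chart_at (c t) \o c) t 1.

Definition velocity (R : realType) (n : nat) (M : smoothManifoldType R n)
    (c : R -> M) (t : R) : tangent (c t) := derive1 (chart_at (c t) \o c) t.

Section LieGroupTheory.
Context {R : realType} {n : nat} {G : lieGroupType R n}.

Definition lie_algebra : Type := tangent (1%g : G).

Definition Ltrans (h g : G) : G := (h * g)%g.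
Definition Rtrans (h g : G) : G := (g * h)%g.

(* T_(g^-1 * g) G and T_(g * g^-1) G are T_1 G because the base points are
   equal; the codings by 'rV_n agree. *)
Definition Ad (g : G) (v : lie_algebra) : lie_algebra :=
  @tangent_map R n n G G (Rtrans g^-1%g) g
    (@tangent_map R n n G G (Ltrans g) 1%g v).

Definition left_velocity (c : R -> G) (t : R) : lie_algebra :=
  @tangent_map R n n G G (Ltrans (c t)^-1%g) (c t) (velocity c t).

Definition right_velocity (c : R -> G) (t : R) : lie_algebra :=
  @tangent_map R n n G G (Rtrans (c t)^-1%g) (c t) (velocity c t).

Definition lambda_pos {N : nat} (g : 'I_N -> R -> G) (i j : 'I_N) (t : R) : G :=
  ((g j t)^-1 * g i t)%g.

Definition rho_pos {N : nat} (g : 'I_N -> R -> G) (i j : 'I_N) (t : R) : G :=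
  (g i t * (g j t)^-1)%g.

Definition constant_on (I : set R) (c : R -> G) : Prop :=
  forall s t, I s -> I t -> c s = c t.

Definition left_coordination {N : nat} (I : set R) (g : 'I_N -> R -> G) : Prop :=
  forall j k, constant_on I (lambda_pos g j k).

Definition right_coordination {N : nat} (I : set R) (g : 'I_N -> R -> G) : Prop :=
  forall j k, constant_on I (rho_pos g j k).

Definition total_coordination {N : nat} (I : set R) (g : 'I_N -> R -> G) : Prop :=
  left_coordination I g /\ right_coordination I g.

End LieGroupTheory.

Arguments lie_algebra {R n} G.

Definition ker (U V : zmodType) (f : U -> V) : set U := [set x | f x = 0].

(* Main.v *)
Require Import Defs.
From HB Require Import structures.
From mathcomp Require Import all_boot all_order all_algebra.
From mathcomp Require Import boolp classical_sets functions reals.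
From mathcomp Require Import topology normedtype landau derive.

Set Implicit Arguments.
Unset Strict Implicit.
Unset Printing Implicit Defensive.

Import Order.TTheory GRing.Theory Num.Theory.
Import numFieldNormedType.Exports.

Local Open Scope classical_set_scope.
Local Open Scope ring_scope.

(* A product of curves satisfies
     xi^l(c d) = Ad_(d^-1) xi^l(c) + xi^l(d),  xi^r(c d) = xi^r(c) + Ad_c xi^r(d),
   and a curve on an open interval is constant iff its velocity vanishes.
   Applied to g_i = g_j lambda_ij and g_i = rho_ij g_j, where
   lambda_ij^-1 = lambda_ji, this gives
     lambda constant <-> xi^l_j = Ad_(lambda_ij) xi^l_i <-> xi^r_i = xi^r_j,
     rho constant    <-> xi^l_i = xi^l_j <-> xi^r_i = Ad_(rho_ij) xi^r_j
   for all i and j. *)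

(** The expansion at [x] depends only on the germ there. This serves below because a chart and its
    inverse cancel only near the base point. *)
Lemma near_eq_is_diff (R : numFieldType) (V W : normedModType R) (f g : V -> W)
    (x : V) (df : V -> W) :
  (\near x, f x = g x) -> is_diff x f df -> is_diff x g df.
Proof.
move=> fg [dfx <-].
have [dfc dfo] := (diff_locallyP _ _).1 dfx.
have gx : f x = g x by exact: nbhs_singleton fg.
have dgo : g \o shift x = cst (g x) + 'd f x +o_ 0 id.
  apply/eqaddoP => e e0; move/eqaddoP: dfo => /(_ e e0).
  (* The remainder is estimated near [0], after the shift by [x], so [fg] is transported there. *)
  apply: filter_app; move: fg; rewrite (near_shift 0) subr0.
  by apply: filter_app; near=> y; rewrite /= !fctE /= => -> ; rewrite gx.
have E := diff_unique dfc dgo.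
by split=> //; apply/diff_locallyP; rewrite E.
Unshelve. all: by end_near. Qed.

(** * Derivatives of maps into a manifold *)

Section ManifoldDerivative.
Context {R : realType} {V : normedModType R}.

(* Derivatives of manifold-valued maps on a normed module: V = R gives
   velocities of curves, V = 'rV_m gives tangent maps read in a chart. *)
Definition mdiff (n : nat) (M : smoothManifoldType R n) (c : V -> M) (x : V)
    (dc : V -> 'rV[R]_n) : Prop :=
  {for x, continuous c} /\ is_diff x (chart_at (c x) \o c) dc.

Lemma mdiff_unique n (M : smoothManifoldType R n) (c : V -> M) x dc dc' :
  mdiff c x dc -> mdiff c x dc' -> dc = dc'.
Proof. by move=> [_ [_ <-]] [_ [_ <-]]. Qed.

Lemma mdiff_cst n (M : smoothManifoldType R n) (p : M) (x : V) :
  mdiff (cst p) x (fun=> 0).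
Proof.
split; first exact: cst_continuous.
exact: (@is_diff_cst _ _ _ (chart_at p p)).
Qed.

End ManifoldDerivative.

(** * Preferred charts and chain rules *)

Section Charts.
Context {R : realType} {n : nat} {M : smoothManifoldType R n}.
Implicit Types p : M.

Lemma chart_at_homeo p : chart_homeomorphism (chart_at p).
Proof. exact: atlas_homeomorphism (chart_at_atlas p). Qed.

Lemma chart_at_img p : chart_img (chart_at p) (chart_at p p).
Proof. by exists p => //; exact: chart_at_dom. Qed.

Lemma chart_atK p q : chart_dom (chart_at p) q ->
  chart_inv (chart_at p) (chart_at p q) = q.
Proof. by have [_ _ H _ _] := chart_at_homeo p; exact: H. Qed.

Lemma near_chart_dom p : \forall q \near p, chart_dom (chart_at p) q.
Proof.
apply: open_nbhs_nbhs; split; last exact: chart_at_dom.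
by have [] := chart_at_homeo p.
Qed.

(** In its own chart the inverse chart reads as the identity. It is the generic map through [p]:
    differentiating along it computes tangent maps at [p]. *)
Lemma mdiff_chart_inv p : mdiff (chart_inv (chart_at p)) (chart_at p p) id.
Proof.
have [_ oi _ _ ci] := chart_at_homeo p; split; first exact: ci (chart_at_img p).
rewrite chart_atK; last exact: chart_at_dom.
apply: (near_eq_is_diff _ (is_diff_id _)).
near=> x; have : chart_img (chart_at p) x.
  near: x; apply: open_nbhs_nbhs; split=> //; exact: chart_at_img.
by move=> [q qd <-] /=; rewrite chart_atK.
Unshelve. all: by end_near. Qed.

End Charts.

(** The coordinate form [F] of [f] is differentiable, and its differential at [(v, w)] is the sum of
    its values at [(v, 0)] and [(0, w)], the two partial tangent maps. *)
Lemma mdiff_comp2 (R : realType) (V : normedModType R) m1 m2 n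
    (M1 : smoothManifoldType R m1) (M2 : smoothManifoldType R m2)
    (P : smoothManifoldType R n) (f : M1 -> M2 -> P)
    (c : V -> M1) (d : V -> M2) (x : V) dc dd :
  smooth_map2 f -> mdiff c x dc -> mdiff d x dd ->
  mdiff (fun y => f (c y) (d y)) x
    (fun v => tangent_map (f^~ (d x)) (dc v : tangent (c x)) +
              tangent_map (f (c x)) (dd v : tangent (d x))).
Proof.
move=> [fc fs] [cc cd] [dc' dd'].
have fcd : {for x, continuous (fun y => f (c y) (d y))}.
  by apply: (continuous_comp (f := fun y => (c y, d y)) (cvg_pair cc dc') (fc _)).
split=> //.
set p := c x; set q := d x.
pose F := fun y : 'rV[R]_m1 * 'rV[R]_m2 => chart_at (f p q)
  (f (chart_inv (chart_at p) y.1) (chart_inv (chart_at q) y.2)).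
have FE : differentiable F (chart_at p p, chart_at q q).
  have [] := fs _ _ _ (chart_at_atlas p) (chart_at_atlas q)
    (chart_at_atlas (f p q)) 1%N.
  move=> H _; apply: H; split; try exact: chart_at_img.
  by rewrite /= !chart_atK; try exact: chart_at_dom.
have FD := differentiableP FE.
(* Freezing the second argument amounts to composing [F] with an insertion whose differential is
   [v |-> (v, 0)]. *)
have FL v : 'd F (chart_at p p, chart_at q q) (v, 0)
    = tangent_map (f^~ q) (v : tangent p).
  rewrite /tangent_map.
  have -> : chart_at (f p q) \o f^~ q \o chart_inv (chart_at p) =
     F \o (fun y => (y, cst (chart_at q q) y)).
    by apply/funext => y; rewrite /F /= chart_atK//; exact: chart_at_dom.
  have H := @is_diff_comp _ _ _ _ _ _ _ _ _
    (is_diff_pair (is_diff_id (chart_at p p)) (is_diff_cst (chart_at q q) _)) FD.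
  by rewrite (@diff_val _ _ _ _ _ _ _ H).
have FR v : 'd F (chart_at p p, chart_at q q) (0, v)
    = tangent_map (f p) (v : tangent q).
  rewrite /tangent_map.
  have -> : chart_at (f p q) \o f p \o chart_inv (chart_at q) =
     F \o (fun y => (cst (chart_at p p) y, y)).
    by apply/funext => y; rewrite /F /= chart_atK//; exact: chart_at_dom.
  have H := @is_diff_comp _ _ _ _ _ _ _ _ _
    (is_diff_pair (is_diff_cst (chart_at p p) _) (is_diff_id (chart_at q q))) FD.
  by rewrite (@diff_val _ _ _ _ _ _ _ H).
have H := @is_diff_comp _ _ _ _ _ _ _ _ _ (is_diff_pair cd dd') FD.
(* Charts cancel only on their domains, where continuity keeps [c] and [d] near [x]. *)
apply: (@near_eq_is_diff _ _ _ (F \o (fun y => ((chart_at p \o c) y, (chart_at q \o d) y)))).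
  near=> y; rewrite /F /= !chart_atK//.
    by near: y; apply: dc'; exact: near_chart_dom.
  by near: y; apply: cc; exact: near_chart_dom.
rewrite [X in is_diff _ _ X](_ : _ = 'd F (chart_at p p, chart_at q q) \o (fun v => (dc v, dd v)))//.
apply/funext => v /=; rewrite -FL -FR -linearD; congr ('d F _ _).
by congr pair; rewrite /= ?addr0 ?add0r.
Unshelve. all: by end_near. Qed.

Lemma mdiff_comp (R : realType) (V : normedModType R) m n
    (M : smoothManifoldType R m) (P : smoothManifoldType R n)
    (f : M -> P) (c : V -> M) (x : V) dc :
  smooth_map f -> mdiff c x dc ->
  mdiff (f \o c) x (fun v => tangent_map f (dc v : tangent (c x))).
Proof.
move=> [fc fs] [cc cd]; split; first exact: continuous_comp (fc _).
set p := c x.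
have FD : differentiable (chart_at (f p) \o f \o chart_inv (chart_at p)) (chart_at p p).
  have [H _] := fs _ _ (chart_at_atlas p) (chart_at_atlas (f p)) 1%N.
  apply: H; split; first exact: chart_at_img.
  by rewrite chart_atK; exact: chart_at_dom.
have H := @is_diff_comp _ _ _ _ _ _ _ _ _ cd (differentiableP FD).
apply: near_eq_is_diff H; near=> y; rewrite /= chart_atK//.
by near: y; apply: cc; exact: near_chart_dom.
Unshelve. all: by end_near. Qed.

(** * Tangent maps of translations, adjoint action and velocities *)

Section Translations.
Context {R : realType} {n : nat} {G : lieGroupType R n}.
Implicit Types h k p : G.

(** The base point [chart_inv (chart_at p) (chart_at p p)] has to be identified with [p]. Identities
    between tangent maps then follow by differentiating one map in two ways. *)
Lemma tangent_mapE (m : nat) (P : smoothManifoldType R m) (f : G -> P) p df :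
  mdiff (f \o chart_inv (chart_at p)) (chart_at p p) df ->
  tangent_map (p := p) f = df.
Proof.
move=> [_ [_ <-]] /=.
by rewrite chart_atK; last exact: chart_at_dom.
Qed.

Local Notation dL h p := (@tangent_map R n n G G (Ltrans h) p).
Local Notation dR h p := (@tangent_map R n n G G (Rtrans h) p).

Lemma tangent_map0 (f : G -> G) p : tangent_map (p := p) f (0 : 'rV[R]_n) = 0.
Proof. exact: linear0. Qed.

Lemma tangent_mapD (f : G -> G) p (u v : 'rV[R]_n) :
  tangent_map (p := p) f (u + v) = tangent_map (p := p) f u + tangent_map (p := p) f v.
Proof. exact: linearD. Qed.

Section Curves.
Context {V : normedModType R}.
Implicit Types (c d : V -> G) (x : V).

Lemma mdiff_mul c d x dc dd : mdiff c x dc -> mdiff d x dd ->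
  mdiff (fun y => (c y * d y)%g) x
    (fun v => dR (d x) (c x) (dc v) + dL (c x) (d x) (dd v)).
Proof. exact: mdiff_comp2 lie_mul_smooth. Qed.

(** A product with constant first factor, whose derivative contributes [0]. *)
Lemma mdiff_Ltrans h c x dc : mdiff c x dc ->
  mdiff (Ltrans h \o c) x (fun v => dL h (c x) (dc v)).
Proof.
move=> /(mdiff_mul (mdiff_cst h x)); congr mdiff.
by apply/funext => v; rewrite tangent_map0 add0r.
Qed.

Lemma mdiff_Rtrans h c x dc : mdiff c x dc ->
  mdiff (Rtrans h \o c) x (fun v => dR h (c x) (dc v)).
Proof.
move=> /mdiff_mul/(_ (mdiff_cst h x)); congr mdiff.
by apply/funext => v; rewrite tangent_map0 addr0.
Qed.

End Curves.

(** By associativity both sides differentiate the same map along the inverse chart at [p]. *)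
Lemma dL_comp h k p v : dL h (k * p)%g (dL k p v) = dL (h * k)%g p v.
Proof.
have := mdiff_Ltrans h (mdiff_Ltrans k (mdiff_chart_inv p)).
rewrite /= chart_atK; last exact: chart_at_dom.
have -> : Ltrans h \o (Ltrans k \o chart_inv (chart_at p)) =
    Ltrans (h * k)%g \o chart_inv (chart_at p).
  by apply/funext => y; rewrite /Ltrans /= mulgA.
by move=> /tangent_mapE ->.
Qed.

Lemma dR_comp h k p v : dR h (p * k)%g (dR k p v) = dR (k * h)%g p v.
Proof.
have := mdiff_Rtrans h (mdiff_Rtrans k (mdiff_chart_inv p)).
rewrite /= chart_atK; last exact: chart_at_dom.
have -> : Rtrans h \o (Rtrans k \o chart_inv (chart_at p)) =
    Rtrans (k * h)%g \o chart_inv (chart_at p).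
  by apply/funext => y; rewrite /Rtrans /= mulgA.
by move=> /tangent_mapE ->.
Qed.

(** Left and right translations commute by associativity, and the derivative of their composite is
    unique. *)
Lemma dL_dR h k p v : dL h (p * k)%g (dR k p v) = dR k (h * p)%g (dL h p v).
Proof.
have := mdiff_Rtrans k (mdiff_Ltrans h (mdiff_chart_inv p)).
rewrite /= chart_atK; last exact: chart_at_dom.
have -> : Rtrans k \o (Ltrans h \o chart_inv (chart_at p)) =
    Ltrans h \o (Rtrans k \o chart_inv (chart_at p)).
  by apply/funext => y; rewrite /Rtrans /Ltrans /= mulgA.
have := mdiff_Ltrans h (mdiff_Rtrans k (mdiff_chart_inv p)).
rewrite /= chart_atK; last exact: chart_at_dom.
by move=> H /(mdiff_unique H)/(congr1 (@^~ v)).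
Qed.

Lemma dL1 p v : dL 1%g p v = v.
Proof.
have := mdiff_chart_inv p.
have {1}-> : chart_inv (chart_at p) = Ltrans 1%g \o chart_inv (chart_at p).
  by apply/funext => y; rewrite /Ltrans /= mul1g.
by move=> /tangent_mapE ->.
Qed.

Lemma dR1 p v : dR 1%g p v = v.
Proof.
have := mdiff_chart_inv p.
have {1}-> : chart_inv (chart_at p) = Rtrans 1%g \o chart_inv (chart_at p).
  by apply/funext => y; rewrite /Rtrans /= mulg1.
by move=> /tangent_mapE ->.
Qed.

Lemma dL_eq0 h p v : dL h p v = 0 -> v = 0.
Proof.
move=> hv; rewrite -[v](dL1 v) -(mulVg h) -dL_comp hv.
exact: (tangent_map0 (Ltrans h^-1%g) (h * p)%g).
Qed.

Lemma dR_eq0 h p v : dR h p v = 0 -> v = 0.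
Proof.
move=> hv; rewrite -[v](dR1 v) -(mulgV h) -dR_comp hv.
exact: (tangent_map0 (Rtrans h^-1%g) (p * h)%g).
Qed.

Lemma Ad_eq0 h (v : lie_algebra G) : Ad h v = 0 -> v = 0.
Proof. by move/dR_eq0/dL_eq0. Qed.

Lemma Ad0 h : Ad h (0 : 'rV[R]_n) = 0 :> lie_algebra G.
Proof. by rewrite /Ad !tangent_map0. Qed.

(** The velocity is the differential evaluated at the unit vector of [R]. *)
Lemma mdiff_curve (c : R -> G) t dc :
  mdiff c t dc -> differentiable_curve c t /\ velocity c t = dc 1.
Proof.
move=> [cc [cd <-]]; split; first by split=> //; exact/derivable1_diffP.
by rewrite /velocity derive1E'.
Qed.

Lemma differentiable_curve_mdiff (c : R -> G) t :
  differentiable_curve c t -> exists dc, mdiff c t dc.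
Proof.
by move=> [cc /derivable1_diffP cd]; exists ('d (chart_at (c t) \o c) t).
Qed.

Lemma differentiable_curve_mul (c d : R -> G) t :
  differentiable_curve c t -> differentiable_curve d t ->
  differentiable_curve (fun s => (c s * d s)%g) t /\
  velocity (fun s => (c s * d s)%g) t =
    dR (d t) (c t) (velocity c t) + dL (c t) (d t) (velocity d t).
Proof.
move=> /differentiable_curve_mdiff[dc cc] /differentiable_curve_mdiff[dd cd].
have [_ ->] := mdiff_curve cc; have [_ ->] := mdiff_curve cd.
exact: mdiff_curve (mdiff_mul cc cd).
Qed.

(** Differentiability suffices: velocities of relative positions are reached through factorizations
    such as [g_i = g_j lambda_ij], not through the derivative of the inverse. *)
Lemma differentiable_curve_inv (c : R -> G) t :
  differentiable_curve c t -> differentiable_curve (fun s => (c s)^-1%g) t.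
Proof.
move=> /differentiable_curve_mdiff[dc cc].
by have [] := mdiff_curve (mdiff_comp lie_inv_smooth cc).
Qed.

(** Pulled back to the identity, the product rule puts [L_(d^-1) L_(c^-1) R_d] on the velocity of
    [c]; moving [R_d] outermost turns this into [Ad_(d^-1)] of the left velocity. *)
Lemma left_velocity_mul (c d : R -> G) t :
  differentiable_curve c t -> differentiable_curve d t ->
  left_velocity (fun s => (c s * d s)%g) t =
  Ad (d t)^-1%g (left_velocity c t) + left_velocity d t.
Proof.
move=> cc cd; rewrite /left_velocity /Ad.
rewrite (differentiable_curve_mul cc cd).2 tangent_mapD invgM; congr (_ + _).
  (* [Ad] takes its inner tangent map at [1], so the base point of this instance is rewritten by
     [mulVg]. *)
  have := dL_comp (d t)^-1%g (c t)^-1%g (velocity c t).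
  by rewrite mulVg => ->; rewrite dL_dR mulgVK invgK.
by rewrite dL_comp mulgVK.
Qed.

Lemma right_velocity_mul (c d : R -> G) t :
  differentiable_curve c t -> differentiable_curve d t ->
  right_velocity (fun s => (c s * d s)%g) t =
  right_velocity c t + Ad (c t) (right_velocity d t).
Proof.
move=> cc cd; rewrite /right_velocity /Ad.
rewrite (differentiable_curve_mul cc cd).2 tangent_mapD invgM; congr (_ + _).
  by rewrite dR_comp mulVKg.
have := dL_dR (c t) (d t)^-1%g (velocity d t).
rewrite mulgV => ->.
have := dR_comp (c t)^-1%g (d t)^-1%g (tangent_map (Ltrans (c t)) (velocity d t)).
by rewrite mulgK => ->.
Qed.

Lemma left_velocity_eq0 (c : R -> G) t : left_velocity c t = 0 <-> velocity c t = 0.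
Proof.
split; first exact: dL_eq0.
by rewrite /left_velocity => ->; rewrite tangent_map0.
Qed.

Lemma right_velocity_eq0 (c : R -> G) t : right_velocity c t = 0 <-> velocity c t = 0.
Proof.
split; first exact: dR_eq0.
by rewrite /right_velocity => ->; rewrite tangent_map0.
Qed.

End Translations.

(** The mean value theorem concerns real-valued functions, so it is applied to each matrix entry. *)
Lemma derive0_constant_on_interval (R : realType) m n (F : R -> 'M[R]_(m, n))
    (A : set R) :
  is_interval A -> (forall s, A s -> is_derive s 1 F 0) ->
  forall s t, A s -> A t -> F s = F t.
Proof.
move=> Ai F0 s t; wlog st : s t / s <= t => [H As At|As At].
  by case: (leP s t) => [/H->|/ltW/H->].
have AF u : u \in `[s, t]%R -> is_derive u 1 F 0.
  by rewrite in_itv /= => /(Ai _ _ As At) /F0.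
apply/matrixP => i j.
have Aj u : u \in `[s, t]%R -> is_derive u 1 (fun x => F x i j) 0.
  move=> /AF [Fu Fu0]; split; first exact: (derivable_mxP _ _ _).1 Fu i j.
  by move/matrixP: Fu0 => /(_ i j); rewrite derive_mx// !mxE.
have Fc : {within `[s, t], continuous (fun x => F x i j)}.
  by apply: derivable_within_continuous => u ust; have [] := Aj u ust.
have Fo u : u \in `]s, t[%R -> is_derive u 1 (fun x => F x i j) 0.
  by move=> ust; apply: Aj; exact: subset_itv_oo_cc ust.
have [r _] := @MVT_segment _ _ (fun=> 0) _ _ st Fo Fc.
by rewrite mul0r => /subr0_eq.
Qed.

(** * Constancy and zero velocity for curves *)

Section ConstantCurves.
Context {R : realType} {n : nat} {M : smoothManifoldType R n}.
Variables (I : set R) (c : R -> M).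
Hypothesis I_open : open I.

(** Openness of [I] makes the chart reading constant near [t], which is all that the derivative
    sees. *)
Lemma constant_velocity0 t :
  (forall s t, I s -> I t -> c s = c t) -> I t -> velocity c t = 0.
Proof.
move=> cI It; rewrite /velocity derive1E.
rewrite (@near_eq_derive _ _ _ _ (cst (chart_at (c t) (c t)))) ?derive_cst//.
near=> s; rewrite /= (cI s t)//; near: s.
exact: open_nbhs_nbhs.
Unshelve. all: by end_near. Qed.

Hypothesis c_diff : forall t, I t -> differentiable_curve c t.
Hypothesis c_vel0 : forall t, I t -> velocity c t = 0.

(** [velocity] is read in a chart that moves with [t]. The differentiable transition map carries the
    zero derivative to the fixed chart at [p], so that a whole interval of times can be treated at
    once. *)
Lemma velocity0_chart_derive0 p t : I t -> chart_dom (chart_at p) (c t) ->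
  is_derive t 1 (chart_at p \o c) 0.
Proof.
move=> It pct; have [cc /derivable1_diffP cd] := c_diff It.
pose psi := chart_at (c t).
have trans : differentiable (chart_at p \o chart_inv psi) (psi (c t)).
  have [H _] := atlas_compatible _ _ (chart_at_atlas (c t)) (chart_at_atlas p) 1%N.
  by apply: H; exists (c t) => //; split=> //; exact: chart_at_dom.
have H := is_diff_comp (differentiableP cd) (differentiableP trans).
have Fd : is_diff t (chart_at p \o c)
    ('d (chart_at p \o chart_inv psi) (psi (c t)) \o 'd (psi \o c) t).
  apply: near_eq_is_diff H; near=> s; rewrite /= chart_atK//.
  near: s; apply: cc; exact: near_chart_dom.
split; first by apply/derivable1_diffP; exact: ex_diff.
rewrite deriveE; last exact: ex_diff.
rewrite (diff_val (is_diff_def := Fd)) /= -(derive1E' cd).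
by have := c_vel0 It; rewrite /velocity => ->; rewrite linear0.
Unshelve. all: by end_near. Qed.

(** On a small ball of times the curve stays in one chart domain; its coordinates are constant
    there, and the chart is injective on its domain. *)
Lemma velocity0_near_constant t : I t -> \forall s \near t, c s = c t.
Proof.
move=> It; have [cc _] := c_diff It.
have : \forall s \near t, I s /\ chart_dom (chart_at (c t)) (c s).
  near=> s; split; near: s; first exact: open_nbhs_nbhs.
  by apply: cc; exact: near_chart_dom.
move=> /nbhs_ballP[e /= e0 te]; apply/nbhs_ballP; exists e => //= s se.
have tt : ball t e t by exact: ballxx.
have [_ sd] := te _ se; have [_ td] := te _ tt.
rewrite -(chart_atK sd) -[RHS](chart_atK td); congr (chart_inv _ _).
apply: (@derive0_constant_on_interval _ _ _ (chart_at (c t) \o c) (ball t e)) => //.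
  by rewrite ball_itv; exact: interval_is_interval.
by move=> u /te[Iu ud]; exact: velocity0_chart_derive0.
Unshelve. all: by end_near. Qed.

(** One chart need not contain the whole curve, so local constancy is propagated by connectedness:
    the times with value [c t] form a nonempty, relatively open and closed subset of [I]. *)
Lemma velocity0_constant : is_interval I ->
  forall s t, I s -> I t -> c s = c t.
Proof.
move=> /connected_intervalP Ic s t Is It.
pose B := [set u | I u /\ c u = c t].
suff BI : B = I.
  by have [] : B s; rewrite ?BI.
have loc u : I u -> \forall v \near u, I v /\ c v = c u.
  move=> Iu; near=> v; split; near: v; first exact: open_nbhs_nbhs.
  exact: velocity0_near_constant.
apply: Ic; first by exists t.
  exists B; last by apply/seteqP; split=> [u [Iu cu]|u []].
  rewrite openE => u [Iu cu]; near=> v.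
  by have [] : I v /\ c v = c u by [near: v; exact: loc]; rewrite /B /= cu.
(* By local constancy the times in [I] with another value also form an open set; its complement
   meets [I] in [B]. *)
exists (~` [set u | I u /\ c u <> c t]); last first.
  apply/seteqP; split=> [u [Iu cu]|u [Iu] ncu]; first by split=> // -[_].
  by split=> //; apply: contrapT => cu; apply: ncu.
apply: open_closedC; rewrite openE => u [Iu cu]; near=> v.
by have [] : I v /\ c v = c u by [near: v; exact: loc]; rewrite /= => ? ->.
Unshelve. all: by end_near. Qed.

End ConstantCurves.

(** * Coordination expressed by velocities *)

Section Coordination.
Context {R : realType} {n : nat} {G : lieGroupType R n}.
Variables (N : nat) (I : set R) (g : 'I_N -> R -> G).
Hypotheses (I_open : open I) (I_interval : is_interval I).

Lemma constant_onP (c : R -> G) :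
  (forall t, I t -> differentiable_curve c t) ->
  constant_on I c <-> forall t, I t -> velocity c t = 0.
Proof.
move=> cd; split=> [cI t|c0]; first exact: constant_velocity0.
exact: velocity0_constant.
Qed.

Hypothesis g_diff : forall k t, I t -> differentiable_curve (g k) t.
Implicit Types i j k : 'I_N.

Lemma lambda_diff i j t : I t -> differentiable_curve (lambda_pos g i j) t.
Proof.
move=> It.
exact: (differentiable_curve_mul (differentiable_curve_inv (g_diff j It)) (g_diff i It)).1.
Qed.

Lemma rho_diff i j t : I t -> differentiable_curve (rho_pos g i j) t.
Proof.
move=> It.
exact: (differentiable_curve_mul (g_diff i It) (differentiable_curve_inv (g_diff j It))).1.
Qed.

Lemma lambdaE i j : g i = fun t => (g j t * lambda_pos g i j t)%g.
Proof. by apply/funext => t; rewrite mulVKg. Qed.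

Lemma rhoE i j : g i = fun t => (rho_pos g i j t * g j t)%g.
Proof. by apply/funext => t; rewrite mulgVK. Qed.

Lemma lambdaV i j t : ((lambda_pos g i j t)^-1 = lambda_pos g j i t)%g.
Proof. by rewrite invgM invgK. Qed.

Lemma left_coordinationP :
  left_coordination I g <-> forall i j t, I t -> velocity (lambda_pos g i j) t = 0.
Proof.
by split=> H i j; have := H i j; move/(constant_onP (@lambda_diff i j)).
Qed.

Lemma right_coordinationP :
  right_coordination I g <-> forall i j t, I t -> velocity (rho_pos g i j) t = 0.
Proof.
by split=> H i j; have := H i j; move/(constant_onP (@rho_diff i j)).
Qed.

Lemma left_coordination_left_velocity :
  left_coordination I g <-> forall i j t, I t ->
    left_velocity (g j) t = Ad (lambda_pos g i j t) (left_velocity (g i) t).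
Proof.
have E i j t : I t -> left_velocity (g j) t =
    Ad (lambda_pos g i j t) (left_velocity (g i) t) + left_velocity (lambda_pos g j i) t.
  move=> It; rewrite -lambdaV -left_velocity_mul -?lambdaE//; [exact: g_diff|exact: lambda_diff].
rewrite left_coordinationP; split=> H i j t It.
  by rewrite (E i j)// (left_velocity_eq0 (lambda_pos g j i) t).2 ?addr0//; exact: H.
(* The velocity of [lambda_ij] is the error term of [E j i], with exchanged indices. *)
apply/left_velocity_eq0; apply: (@addrI _ (Ad (lambda_pos g j i t) (left_velocity (g j) t))).
by rewrite -E// addr0 (H j i).
Qed.

(** The difference of the two left velocities is [Ad_(g_j^-1)] of the left velocity of [rho_ij], and
    [Ad] is injective. *)
Lemma right_coordination_left_velocity :
  right_coordination I g <-> forall i j t, I t ->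
    left_velocity (g i) t = left_velocity (g j) t.
Proof.
have E i j t : I t -> left_velocity (g i) t =
    Ad (g j t)^-1%g (left_velocity (rho_pos g i j) t) + left_velocity (g j) t.
  move=> It; rewrite -left_velocity_mul -?rhoE//; [exact: rho_diff|exact: g_diff].
rewrite right_coordinationP; split=> H i j t It.
  by rewrite (E i j)// (left_velocity_eq0 (rho_pos g i j) t).2 ?Ad0 ?add0r//; exact: H.
apply/left_velocity_eq0/(Ad_eq0 (h := (g j t)^-1%g)); apply: (@addIr _ (left_velocity (g j) t)).
by rewrite -E// add0r (H i j).
Qed.

(** Here the difference is [Ad_(g_j)] of the right velocity of [lambda_ij]. *)
Lemma left_coordination_right_velocity :
  left_coordination I g <-> forall i j t, I t ->
    right_velocity (g i) t = right_velocity (g j) t.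
Proof.
have E i j t : I t -> right_velocity (g i) t =
    right_velocity (g j) t + Ad (g j t) (right_velocity (lambda_pos g i j) t).
  move=> It; rewrite -right_velocity_mul -?lambdaE//; [exact: g_diff|exact: lambda_diff].
rewrite left_coordinationP; split=> H i j t It.
  by rewrite (E i j)// (right_velocity_eq0 (lambda_pos g i j) t).2 ?Ad0 ?addr0//; exact: H.
apply/right_velocity_eq0/(Ad_eq0 (h := g j t)); apply: (@addrI _ (right_velocity (g j) t)).
by rewrite -E// addr0 (H i j).
Qed.

Lemma right_coordination_right_velocity :
  right_coordination I g <-> forall i j t, I t ->
    right_velocity (g i) t = Ad (rho_pos g i j t) (right_velocity (g j) t).
Proof.
have E i j t : I t -> right_velocity (g i) t =
    right_velocity (rho_pos g i j) t + Ad (rho_pos g i j t) (right_velocity (g j) t).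
  move=> It; rewrite -right_velocity_mul -?rhoE//; [exact: rho_diff|exact: g_diff].
rewrite right_coordinationP; split=> H i j t It.
  by rewrite (E i j)// (right_velocity_eq0 (rho_pos g i j) t).2 ?add0r//; exact: H.
apply/right_velocity_eq0; apply: (@addIr _ (Ad (rho_pos g i j t) (right_velocity (g j) t))).
by rewrite -E// add0r (H i j).
Qed.

End Coordination.

(** Passes from the pairwise conditions given by the velocity criteria to a common vector. Abstract
    [u] and [A] let it serve both the left and the right version. *)
Lemma common_fixed_vectorP (T : Type) (U : zmodType) (N : nat) (I : set T)
    (u : 'I_N -> T -> U) (A : 'I_N -> 'I_N -> T -> U -> U) :
  (forall i j t, I t -> u i t = u j t /\ A i j t (u i t) = u i t) <->
  exists xi : T -> U, forall t, I t ->
    (forall k, u k t = xi t) /\ (\bigcap_i \bigcap_j ker (A i j t \- idfun)) (xi t).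
Proof.
split=> [H|[xi H] i j t It]; last first.
  have [uk uA] := H t It; rewrite !uk; split=> //.
  by have /subr0_eq := uA i Logic.I j Logic.I.
case: N u A H => [|N] u A H.
  (* Without agents no velocity can serve as witness; the default [0] works because every condition
     ranges over an empty index set. *)
  by exists (fun=> 0) => t It; split=> [[]|[]].
exists (u ord0) => t It; split=> [k|i _ j _]; first by have [] := H k ord0 t It.
have [iE iA] := H i j t It; have [<- _] := H i ord0 t It.
by rewrite /ker /= iA subrr.
Qed.

Theorem proposition2 (R : realType) (n : nat) (G : lieGroupType R n)
    (N : nat) (I : set R) (g : 'I_N -> R -> G)
    (I_open : open I) (I_interval : is_interval I)
    (g_diff : forall k t, I t -> differentiable_curve (g k) t) :
  (total_coordination I g <->
     exists xi : R -> lie_algebra G, forall t, I t ->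
       (forall k, left_velocity (g k) t = xi t) /\
       (\bigcap_i \bigcap_j ker (Ad (lambda_pos g i j t) \- idfun)) (xi t)) /\
  (total_coordination I g <->
     exists xi : R -> lie_algebra G, forall t, I t ->
       (forall k, right_velocity (g k) t = xi t) /\
       (\bigcap_i \bigcap_j ker (Ad (rho_pos g i j t) \- idfun)) (xi t)).
Proof.
have LL := left_coordination_left_velocity I_open I_interval g_diff.
have RL := right_coordination_left_velocity I_open I_interval g_diff.
have LR := left_coordination_right_velocity I_open I_interval g_diff.
have RR := right_coordination_right_velocity I_open I_interval g_diff.
split.
  apply: iff_trans (common_fixed_vectorP I (fun k => left_velocity (g k))
    (fun i j t => Ad (lambda_pos g i j t))).
  (* Right coordination equates the left velocities; left coordination then makes their common value
     fixed by each [Ad_(lambda_ij)]. *)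
  split=> [[/LL L /RL r] i j t It|H].
    by split; [exact: r|rewrite -L//; exact: r].
  split; [apply/LL|apply/RL] => i j t It; last by have [] := H i j t It.
  by have [<- ->] := H i j t It.
apply: iff_trans (common_fixed_vectorP I (fun k => right_velocity (g k))
  (fun i j t => Ad (rho_pos g i j t))).
(* For right velocities the two kinds of coordination exchange roles. [RR] applies [Ad] to the
   velocity of [j], so the equality from [L] is used first. *)
split=> [[/LR L /RR r] i j t It|H].
  by split; [exact: L|rewrite (L i j)// -r//; exact: L].
split; [apply/LR|apply/RR] => i j t It; first by have [] := H i j t It.
by have [<- ->] := H i j t It.
Qed.
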